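(* Let $M$ be a matroid with ground set $E$ and let $\mathcal{F}=(F_0,\dotsc,F_d)$ be a flag of flats of $M$ of type $(r_0,\dotsc,r_d)$. Let $i$ and $k$ be integers such that $0\leq i\leq d-1$ and $1\leq k\leq r_{i+1}-r_i$. Then the following identity holds in $\mathbb{R}^E$: $$\sum_{F^{(0)}\lessdot\dotsb\lessdot F^{(k)}\leq F_{i+1}} \bigl(e_{F^{(k)}}-e_{F^{(k-1)}}\bigr) \;+\; \sum_{l=1}^{k-1}(-1)^{k-l}\sum_{F^{(0)}\lessdot\dotsb\lessdot F^{(l)}\leq F_{i+1}}\bigl(e_{F_{i+1}}-e_{F^{(l-1)}}\bigr)\;+\;(-1)^k\bigl(e_{F_{i+1}}-e_{F_i}\bigr)\;=\;0,$$ where $F^{(0)}=F_i$ is fixed and, in each sum indexed by chains $F^{(0)}\lessdot\dotsb\lessdot F^{(l)}\leq F_{i+1}$ (with $l=k$ in the first sum), the sets $F^{(1)},\dotsc,F^{(l)}$ vary over all possible flats of $M$ forming such a chain. (This relation is called the $(i,k)$-balancing condition at the cone $\mathfrak{c}_{\mathcal{F}}$.)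
   Context: Let $M$ be a matroid with ground set $E$ and rank function $\mathrm{rk}$. Let $\{e_j\}_{j\in E}$ be the standard basis of $\mathbb{R}^E$; for a subset $F\subset E$ put $e_F=\sum_{j\in F}e_j$ (so $e_\emptyset=0$). For flats $F,F'$ of $M$, write $F\leq F'$ if $F\subset F'$, and write $F\lessdot F'$ (''$F'$ covers $F$'') if $F\leq F'$ and $\mathrm{rk}\,F'=\mathrm{rk}\,F+1$, i.e. there is no flat strictly between $F$ and $F'$. A flag of flats is a tuple $\mathcal{F}=(F_0,\dotsc,F_d)$ of flats of $M$ with $\emptyset=F_0\subsetneq F_1\subsetneq\dotsb\subsetneq F_d=E$. Its type is the tuple $(\mathrm{rk}\,F_0,\dotsc,\mathrm{rk}\,F_d)$, a strictly increasing tuple of integers starting with $0$ and ending with $\mathrm{rk}\,M$. The cone of $\mathcal{F}$ is $\mathfrak{c}_{\mathcal{F}}=\sum_{j=0}^{d-1}\mathbb{R}^+\cdot e_{F_j}+\mathbb{R}\cdot e_E\subset\mathbb{R}^E$, where $\mathbb{R}^+$ denotes the nonnegative reals; the Bergman fan $B(M)$ is the fan in $\mathbb{R}^E$ consisting of all cones $\mathfrak{c}_{\mathcal{F}}$ for flags of flats $\mathcal{F}$ of $M$. (The cone only serves to name the relation.) An empty sum, such as $\sum_{l=1}^{k-1}$ for $k=1$, is $0$. *)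

(* Defs.v *)
(* MathComp *)
From HB Require Import structures.
From mathcomp Require Import all_boot all_order all_algebra.
From mathcomp Require Import reals.

Set Implicit Arguments.
Unset Strict Implicit.
Unset Printing Implicit Defensive.

Import GRing.Theory.
Local Open Scope ring_scope.

(* The ground set is the whole finite type E; [rk_le_card], [rk_mono] and
   [rk_submod] are the standard axioms of a matroid rank function. *)
Record matroid (E : finType) := Matroid {
  rk : {set E} -> nat;
  rk_le_card : forall A, (rk A <= #|A|)%N;
  rk_mono : forall A B : {set E}, A \subset B -> (rk A <= rk B)%N;
  rk_submod : forall A B, (rk (A :|: B) + rk (A :&: B) <= rk A + rk B)%N
}.

Definition flat (E : finType) (M : matroid E) (F : {set E}) : bool :=
  [forall x, (x \notin F) ==> (rk M F < rk M (x |: F))%N].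

Definition covered_by (E : finType) (M : matroid E) (F F' : {set E}) : bool :=
  [&& flat M F, flat M F', F \subset F' & rk M F' == (rk M F).+1].

(* The requirement F_0 = set0 makes set0 a flat, so M is loopless as soon as
   it has a flag of flats. *)
Definition flag_of_flats (E : finType) (M : matroid E) (d : nat)
    (F : d.+1.-tuple {set E}) : bool :=
  [&& all (flat M) F, nth set0 F 0 == set0, nth set0 F d == setT
    & sorted (fun A B : {set E} => A \proper B) F].

Definition flag_type (E : finType) (M : matroid E) (d : nat)
    (F : d.+1.-tuple {set E}) : d.+1.-tuple nat :=
  [tuple of map (rk M) F].

(* C lists F^(1), ..., F^(l) only; F^(0) = A is kept outside the tuple, so that
   F^(j) is [nth set0 (A :: C) j]. *)
Definition cover_chain (E : finType) (M : matroid E) (A B : {set E})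
    (l : nat) (C : l.-tuple {set E}) : bool :=
  path (covered_by M) A C && (last A C \subset B).

(* R^o is R as a module over itself, which makes {ffun E -> R^o} a vector space
   over R. *)
Definition basis_vec (R : realType) (E : finType) (j : E) : {ffun E -> R^o} :=
  [ffun x => (x == j)%:R].

Definition set_vec (R : realType) (E : finType) (F : {set E}) : {ffun E -> R^o} :=
  \sum_(j in F) basis_vec R j.

(* Main.v *)
Require Import Defs.
From HB Require Import structures.
From mathcomp Require Import all_boot all_order all_algebra.
From mathcomp Require Import reals.

Set Implicit Arguments.
Unset Strict Implicit.
Unset Printing Implicit Defensive.

Import GRing.Theory.
Local Open Scope ring_scope.

(** For a flat [G] contained in a flat [B], the flats covering [G] inside [B]
    cut [B :\: G] into disjoint pieces: each [x] in [B :\: G] lies in exactly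
    one of them, the closure of [x |: G]. In terms of vectors ([sum_covers]),
      the sum of e_G' - e_G over the covers G' of G in B is e_B - e_G.

    Write T_l for the sum of e_(F^(l)) - e_(F^(l-1)), and S_l for the sum of
    e_B - e_(F^(l-1)), both over the chains of length l that start at A and stay
    below B. Summing first over the last step F^(l+1) of a chain of length l+1
    ([sum_chainS]), the partition property says that T_(l+1) is the sum of
    e_B - e_(F^(l)) over the chains of length l. Since
      e_B - e_(F^(l)) = (e_B - e_(F^(l-1))) - (e_(F^(l)) - e_(F^(l-1))),
    this gives T_(l+1) = S_l - T_l for l >= 1, and T_1 = e_B - e_A. Unrolling
    this recurrence from T_k down to T_1 ([alternating_unroll]) yields the
    balancing condition. *)

(** * The covers of a flat partition the elements outside it *)

Section Covers.
Variables (E : finType) (M : matroid E).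
Implicit Types (A B C G H : {set E}) (x y : E).

(** By submodularity [B :|: C] has the rank of [B], so that no element of [C]
    can enlarge [B] without raising its rank. This one fact replaces the
    closure operator in what follows. *)
Lemma flat_absorb B C :
  flat M B -> (rk M C <= rk M (C :&: B))%N -> C \subset B.
Proof.
move=> /forallP flB leC; apply/subsetP=> x xC.
apply: contraT => xB; have := implyP (flB x) xB.
have le1 : (rk M (x |: B) <= rk M (C :|: B))%N.
  by apply: rk_mono; apply: setSU; rewrite sub1set.
have := rk_submod M C B; rewrite addnC => sub.
have le2 := leq_trans sub (leq_add leC (leqnn _)).
rewrite leq_add2l in le2.
by rewrite ltnNge (leq_trans le1 le2).
Qed.

Lemma rk_setU1 G x : flat M G -> x \notin G -> rk M (x |: G) = (rk M G).+1.
Proof.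
move=> /forallP flG xG; apply/eqP; rewrite eqn_leq (implyP (flG x) xG) andbT.
have := rk_submod M [set x] G; have := rk_le_card M [set x]; rewrite cards1.
move=> le1 sub; apply: leq_trans (leq_trans (leq_addr _ _) sub) _.
by rewrite -add1n leq_add2r.
Qed.

(** [H :&: H'] contains [x |: G], hence already has the common rank of [H] and
    [H'], and each of these flats absorbs the other. *)
Lemma cover_unique G H H' x :
  covered_by M G H -> covered_by M G H' -> x \notin G -> x \in H -> x \in H' ->
  H = H'.
Proof.
move=> /and4P[flG flH sGH /eqP rH] /and4P[_ flH' sGH' /eqP rH'] xG xH xH'.
have rkI : ((rk M G).+1 <= rk M (H :&: H'))%N.
  rewrite -(rk_setU1 flG xG); apply: rk_mono.
  by rewrite subUset sub1set inE xH xH' subsetI sGH.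
apply/eqP; rewrite eqEsubset !flat_absorb //; first by rewrite setIC rH'.
by rewrite rH.
Qed.

Lemma cover_exists G B x :
  flat M G -> flat M B -> G \subset B -> x \in B -> x \notin G ->
  exists2 H, covered_by M G H && (H \subset B) & x \in H.
Proof.
move=> flG flB sGB xB xG; have rxG := rk_setU1 flG xG.
(* The closure of [x |: G], as a largest set of the same rank above it. *)
pose P H := (x |: G \subset H) && (rk M H == (rk M G).+1).
have [H /maxsetP[/andP[sxH /eqP rH] maxH] _] : {H | maxset P H & x |: G \subset H}.
  by apply: maxset_exists; rewrite /P subxx rxG eqxx.
have [xH sGH] : x \in H /\ G \subset H.
  by move: sxH; rewrite subUset sub1set => /andP[].
exists H => //; rewrite /covered_by flG sGH rH eqxx !andbT /=.
apply/andP; split.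
- apply/forallP=> y; apply/implyP=> yH.
  rewrite ltn_neqAle rk_mono ?subsetUr // andbT.
  apply: contra yH => /eqP ryH.
  rewrite -(maxH (y |: H)) ?setU11 ?subsetUr // /P -ryH rH eqxx andbT.
  exact: subset_trans sxH (subsetUr _ _).
- apply: flat_absorb => //; rewrite rH -rxG; apply: rk_mono.
  by rewrite subsetI sxH subUset sub1set xB.
Qed.

End Covers.

Lemma set_vecE (R : realType) (E : finType) (F : {set E}) (x : E) :
  set_vec R F x = (x \in F)%:R.
Proof.
rewrite /set_vec sum_ffunE; under eq_bigr do rewrite ffunE.
have [xF|xF] := boolP (x \in F).
  rewrite (bigD1 x) //= eqxx big1 ?addr0 // => j /andP[_ /negPf].
  by rewrite eq_sym => ->.
rewrite big1 // => j jF; case: eqP => // xj.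
by rewrite xj jF in xF.
Qed.

(** Evaluated at [x], only the case [x \in B :\: G] matters, and there exactly
    one cover of [G] in [B] contains [x]. If [G = B], both sides vanish. *)
Lemma sum_covers (R : realType) (E : finType) (M : matroid E) (G B : {set E}) :
  flat M G -> flat M B -> G \subset B ->
  \sum_(H | covered_by M G H && (H \subset B)) (set_vec R H - set_vec R G)
    = set_vec R B - set_vec R G.
Proof.
move=> flG flB sGB; apply/ffunP=> x; rewrite sum_ffunE.
have evalB (H K : {set E}) :
    (set_vec R H - set_vec R K) x = (x \in H)%:R - (x \in K)%:R.
  by rewrite !ffunE !set_vecE.
rewrite evalB; under eq_bigr do rewrite evalB.
have [xG|xG] := boolP (x \in G).
  rewrite (subsetP sGB) // subrr big1 // => H /andP[/and4P[_ _ sGH _] _].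
  by rewrite (subsetP sGH) // subrr.
have [xB|xB] := boolP (x \in B); last first.
  rewrite big1 ?subrr // => H /andP[_ sHB].
  by rewrite (contraNF (subsetP sHB x) xB) subrr.
have [H0 H0P xH0] := cover_exists flG flB sGB xB xG.
rewrite (bigD1 H0) //= xH0 big1 ?addr0 // => H /andP[/andP[cH sHB] neH].
case xH: (x \in H); last by rewrite subrr.
have [cH0 _] := andP H0P.
by rewrite (cover_unique cH cH0 xG xH xH0) eqxx in neH.
Qed.

(** * Sums over chains of covers *)

Section Chains.
Variables (E : finType) (M : matroid E).
Implicit Types (A B G : {set E}).

(** [G \subset B] already forces the earlier flats of the chain into [B], so a
    chain below [B] extends a shorter chain below [B]. *)
Lemma cover_chain_rcons A B l (D : l.-tuple {set E}) G :
  cover_chain M A B [tuple of rcons D G] =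
  cover_chain M A B D && (covered_by M (last A D) G && (G \subset B)).
Proof.
rewrite /cover_chain /= rcons_path last_rcons.
case: (path _ A D) => //=.
case cG: (covered_by M (last A D) G) => /=; last by rewrite andbF.
case sGB: (G \subset B) => /=; last by rewrite andbF.
by have /and4P[_ _ sDG _] := cG; rewrite (subset_trans sDG sGB).
Qed.

Lemma cover_chain_last A B l (D : l.-tuple {set E}) :
  flat M A -> cover_chain M A B D -> flat M (last A D) /\ last A D \subset B.
Proof.
move=> flA /andP[pD sB]; split=> //; move: pD; clear sB.
case: D => s _ /=; case/lastP: s => // s G.
by rewrite rcons_path last_rcons => /andP[_ /and4P[]].
Qed.

(** Splitting off the last entry, rather than the head, isolates the last step
    of a chain. *)
Lemma sum_tuple_rcons (T : finType) (V : nmodType) l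
    (P : pred (l.+1.-tuple T)) (f : l.+1.-tuple T -> V) :
  \sum_(C | P C) f C =
  \sum_(D : l.-tuple T) \sum_(t | P [tuple of rcons D t]) f [tuple of rcons D t].
Proof.
rewrite pair_big_dep /=.
rewrite (reindex (fun p : l.-tuple T * T => [tuple of rcons p.1 p.2])) //=.
exists (fun C : l.+1.-tuple T =>
  ([tuple of belast (thead C) (behead C)], last (thead C) (behead C))).
- move=> [D t] _; congr pair => /=; last first.
    by case: D => [[|u s] szD] //=; rewrite last_rcons.
  apply: val_inj; case: D => [[|u s] szD] //=.
  by rewrite belast_rcons.
- move=> C _; apply: val_inj; case/tupleP: C => u C /=.
  by rewrite theadE -lastI.
Qed.

Lemma sum_chainS (V : nmodType) A B l (f : {set E} -> {set E} -> V) :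
  \sum_(C : l.+1.-tuple {set E} | cover_chain M A B C)
     f (nth set0 (A :: C) l) (nth set0 (A :: C) l.+1) =
  \sum_(D : l.-tuple {set E} | cover_chain M A B D)
     \sum_(G | covered_by M (last A D) G && (G \subset B)) f (last A D) G.
Proof.
rewrite sum_tuple_rcons [RHS]big_mkcond; apply: eq_bigr => D _.
under eq_bigl do rewrite cover_chain_rcons.
case: (cover_chain M A B D); last by rewrite big_pred0.
apply: eq_bigr => G _; congr f.
- by rewrite /= -rcons_cons nth_rcons /= size_tuple ltnSn (last_nth set0) size_tuple.
- by rewrite /= nth_rcons size_tuple ltnn eqxx.
Qed.

End Chains.

(** * The balancing condition *)

Lemma alternating_unroll (R : pzRingType) (V : lmodType R) (S T : nat -> V) k :
  (forall l, T l.+2 = S l.+1 - T l.+1) ->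
  T k.+1 + \sum_(1 <= l < k.+1) (-1) ^+ (k.+1 - l) *: S l
    + (-1) ^+ k.+1 *: T 1%N = 0.
Proof.
move=> recT; elim: k => [|k IHk].
  by rewrite big_nil addr0 expr1 scaleN1r subrr.
rewrite recT big_nat_recr //= subSnn expr1 scaleN1r.
rewrite (exprS _ k.+1) mulN1r scaleNr.
rewrite (eq_big_nat _ _ (F2 := fun l => - ((-1) ^+ (k.+1 - l) *: S l))); last first.
  by move=> l /andP[_ lek]; rewrite (subSn (ltnW lek)) exprS mulN1r scaleNr.
rewrite sumrN [X in _ + X + _]addrC addrACA subrr add0r.
by rewrite -opprD -opprD IHk oppr0.
Qed.

(** The first sum is T_(k+1) and the last bracket is T_1; here [T] and [S] are
    the two families of sums whose recurrence the alternating sum unrolls. *)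
Lemma balancing_interval (R : realType) (E : finType) (M : matroid E)
    (A B : {set E}) (k : nat) :
  flat M A -> flat M B -> A \subset B ->
  \sum_(C : k.+1.-tuple {set E} | cover_chain M A B C)
      (set_vec R (nth set0 (A :: C) k.+1) - set_vec R (nth set0 (A :: C) k))
  + \sum_(1 <= l < k.+1) (-1) ^+ (k.+1 - l) *:
      (\sum_(C : l.-tuple {set E} | cover_chain M A B C)
          (set_vec R B - set_vec R (nth set0 (A :: C) l.-1)))
  + (-1) ^+ k.+1 *: (set_vec R B - set_vec R A) = 0.
Proof.
move=> flA flB sAB.
pose T l := \sum_(C : l.-tuple {set E} | cover_chain M A B C)
  (set_vec R (nth set0 (A :: C) l) - set_vec R (nth set0 (A :: C) l.-1)).
pose S l := \sum_(C : l.-tuple {set E} | cover_chain M A B C)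
  (set_vec R B - set_vec R (nth set0 (A :: C) l.-1)).
have TE l : T l.+1 = \sum_(D : l.-tuple {set E} | cover_chain M A B D)
    (set_vec R B - set_vec R (last A D)).
  rewrite /T (sum_chainS M A B l (fun G H => set_vec R H - set_vec R G)).
  apply: eq_bigr => D chD; have [flD sDB] := cover_chain_last flA chD.
  exact: sum_covers.
have T1 : T 1%N = set_vec R B - set_vec R A.
  rewrite TE (bigD1 [tuple]) /=; last by rewrite /cover_chain /= sAB.
  by rewrite big1 ?addr0 // => D /andP[_]; case/eqP; exact: tuple0.
have recT l : T l.+2 = S l.+1 - T l.+1.
  rewrite TE -sumrB; apply: eq_bigr => D _.
  rewrite (last_nth set0) size_tuple opprB addrCA addrA.
  by rewrite [_ + (set_vec R B - _)]addrC subrK addrC.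
by rewrite -T1; exact: alternating_unroll.
Qed.

Theorem theorem2 (R : realType) (E : finType) (M : matroid E) (d : nat)
    (F : d.+1.-tuple {set E}) (r : d.+1.-tuple nat)
    (hF : flag_of_flats M F) (hr : flag_type M F = r)
    (i k : nat) (hi : (i < d)%N)
    (hk : (1 <= k <= nth 0%N r i.+1 - nth 0%N r i)%N) :
  let A := nth set0 F i in
  let B := nth set0 F i.+1 in
  \sum_(C : k.-tuple {set E} | cover_chain M A B C)
      (set_vec R (nth set0 (A :: C) k) - set_vec R (nth set0 (A :: C) k.-1))
  + \sum_(1 <= l < k) (-1) ^+ (k - l) *:
      (\sum_(C : l.-tuple {set E} | cover_chain M A B C)
          (set_vec R B - set_vec R (nth set0 (A :: C) l.-1)))
  + (-1) ^+ k *: (set_vec R B - set_vec R A) = 0.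
Proof.
move=> A B; have /and4P[/allP flF _ _ /(sortedP set0) ltF] := hF.
case: k hk => // k _; apply: balancing_interval.
- by apply: flF; rewrite mem_nth // size_tuple ltnS ltnW.
- by apply: flF; rewrite mem_nth // size_tuple ltnS.
- by apply: proper_sub; apply: ltF; rewrite size_tuple ltnS.
Qed.
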